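(* If $\vartheta$ is a primitive random substitution such that $h_{\mathrm{top}}(X_\vartheta)=0$, then the complexity function $p_{X_\vartheta}(n)$ of $X_\vartheta$ is either $\Theta(1)$ or $\Theta(n)$.
   Context: Let $\mathcal{A}$ be a finite alphabet, $\mathcal{A}^+$ the set of non-empty finite words over $\mathcal{A}$. A random substitution over $\mathcal{A}$ is a map $\vartheta$ assigning to each letter $a\in\mathcal{A}$ a non-empty finite set $\vartheta(a)\subset\mathcal{A}^+$ of realisations (together with a choice of strictly positive probabilities on each $\vartheta(a)$, which plays no role for the subshift and is ignored). For a word $u=u_1\cdots u_n$, $\vartheta(u)=\{w_1\cdots w_n : w_i\in\vartheta(u_i)\}$; powers are defined by $\vartheta^1=\vartheta$ and $\vartheta^k(a)=\bigcup_{v\in\vartheta^{k-1}(a)}\vartheta(v)$. A word is $\vartheta$-legal if it is a (contiguous) subword of some word in $\vartheta^k(a)$ for some $k\in\mathbb{N}$, $a\in\mathcal{A}$; $\mathcal{L}_\vartheta$ is the set of legal words. The subshift of $\vartheta$ is $X_\vartheta=\{w\in\mathcal{A}^{\mathbb{Z}} : \text{every finite subword of } w \text{ lies in } \mathcal{L}_\vartheta\}$ with the left shift. $\vartheta$ is primitive if there is $k\in\mathbb{N}$ such that for all $a,b\in\mathcal{A}$ the letter $a$ occurs in at least one realisation in $\vartheta^k(b)$; by convention, the definition of primitivity is restricted to random substitutions with $X_\vartheta\neq\varnothing$. For a non-empty subshift $X$, the complexity function $p_X(n)$ is the number of distinct words of length $n$ occurring in elements of $X$, and $h_{\mathrm{top}}(X)=\lim_{n\to\infty}\frac1n\log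 p_X(n)$. For positive functions $f,g$ on $\mathbb{N}$, $g=\Theta(f)$ means there exist $C_1,C_2>0$ with $C_1<f(n)/g(n)<C_2$ for all $n\in\mathbb{N}$. *)

(* Defs.v *)
From HB Require Import structures.
From mathcomp Require Import all_boot all_order all_algebra.
From mathcomp Require Import finmap.
From mathcomp Require Import boolp classical_sets reals topology normedtype.
From mathcomp Require Import sequences exp.

Set Implicit Arguments.
Unset Strict Implicit.
Unset Printing Implicit Defensive.

Import Order.TTheory GRing.Theory Num.Theory.
Import numFieldNormedType.Exports.

Local Open Scope classical_set_scope.
Local Open Scope ring_scope.

(* The probabilities attached to the realisations are not recorded: neither
   the subshift nor primitivity depends on them. *)
Record random_substitution (A : finType) := RandomSubstitution {
  realisations :> A -> {fset (seq A)};
  realisations_neq0 : forall a, realisations a != fset0;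
  realisations_nonempty : forall a, [::] \notin realisations a }.

(* [all2] forces [u] and [ws] to have the same size. *)
Definition word_realisations (A : finType) (theta : random_substitution A)
    (u : seq A) : set (seq A) :=
  [set flatten ws | ws in
    [set ws : seq (seq A) | all2 (fun a w => w \in theta a) u ws]].

(* The zeroth power is the identity substitution; see [rs_power1] for the
   first power.  The natural numbers of the theory start at 1, so exponents
   are required to be positive wherever powers are used below. *)
Fixpoint rs_power (A : finType) (theta : random_substitution A) (k : nat)
    (a : A) : set (seq A) :=
  if k is k'.+1 then
    \bigcup_(v in rs_power theta k' a) word_realisations theta v
  else [set [:: a]].

Lemma rs_power1 (A : finType) (theta : random_substitution A) (a : A) :
  rs_power theta 1 a = [set w | w \in theta a].
Proof.
rewrite /rs_power bigcup_set1; apply/seteqP; split=> [w|w /= wa].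
  case=> -[|v [|v' ws]] /=; rewrite ?andbT ?andbF //.
  by move=> va <-; rewrite cats0.
by exists [:: w]; rewrite /= ?wa ?cats0.
Qed.

Definition legal (A : finType) (theta : random_substitution A) (u : seq A) :
    Prop :=
  exists (k : nat) (a : A) (v : seq A),
    [/\ (0 < k)%N, rs_power theta k a v & infix u v].

Definition factor (A : finType) (w : int -> A) (i : int) (n : nat) : seq A :=
  mkseq (fun j => w (i + j%:Z)) n.

Definition subshift (A : finType) (theta : random_substitution A) :
    set (int -> A) :=
  [set w | forall (i : int) (n : nat), legal theta (factor w i n)].

Definition primitive (A : finType) (theta : random_substitution A) : Prop :=
  subshift theta !=set0 /\
  exists k : nat, (0 < k)%N /\
    forall a b : A, exists2 v : seq A, rs_power theta k b v & a \in v.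

Definition complexity (A : finType) (X : set (int -> A)) (n : nat) : nat :=
  #|[pred t : n.-tuple A |
      `[< exists2 w, X w & exists i : int, factor w i n = t >]]|.

(* [h] is the topological entropy of [X].  The term [n = 0] is irrelevant. *)
Definition is_htop (R : realType) (A : finType) (X : set (int -> A)) (h : R) :
    Prop :=
  (fun n : nat => n%:R^-1 * ln ((complexity X n)%:R : R)) @ \oo --> h.

(* [is_Theta g f] reads g = Theta(f). The index [n] starts at 1, which is
   where n |-> n is a positive function. *)
Definition is_Theta (R : realType) (g f : nat -> R) : Prop :=
  exists C1 C2 : R, [/\ 0 < C1, 0 < C2 &
    forall n : nat, (0 < n)%N -> C1 < f n / g n < C2].

(* Main.v *)
Require Import Defs.
From mathcomp Require Import all_boot all_order all_algebra.
From mathcomp Require Import finmap.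
From mathcomp Require Import boolp classical_sets reals topology normedtype.
From mathcomp Require Import sequences exp.
From mathcomp Require Import zify.
Import Order.TTheory GRing.Theory Num.Theory.
Import numFieldNormedType.Exports.

Set Implicit Arguments.
Unset Strict Implicit.
Unset Printing Implicit Defensive.

(* If two distinct words of the same length lie in the same [theta^k(c)], then
   choosing freely between them at a positive proportion of the places of long
   legal words gives exponentially many legal words of equal length.  So zero
   entropy forces realisations of equal length to coincide.  If some
   [theta(a)] has two realisations [u] and [v], these have different lengths,
   and [u x v = v x u] for every realisation [x] of a word [y] with [a y a]
   legal: all legal words are then factors of powers of one fixed word, and
   the complexity is bounded.  Otherwise [theta] is a deterministic primitive
   substitution, whose complexity is at most linear, and the Morse-Hedlund
   theorem gives the dichotomy. *)

(** * Realisations of words under powers of a random substitution *)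

Section Realisations.
Variables (A : finType) (theta : random_substitution A).
Implicit Types (a b c : A) (u v w : seq A) (k : nat).

Lemma word_realisations_nil v : word_realisations theta [::] v <-> v = [::].
Proof.
split=> [[[|x ws] //= _ <- //]|->].
by exists [::].
Qed.

Lemma word_realisations_cons a u v : word_realisations theta (a :: u) v <->
  exists w v', [/\ w \in theta a, word_realisations theta u v' & v = w ++ v'].
Proof.
split=> [[[|w ws] //= /andP[wa wsu] <-]|[w [_ [wa [ws wsu <-] ->]]]].
  by exists w, (flatten ws); split=> //; exists ws.
by exists (w :: ws); rewrite //= wa.
Qed.

Lemma word_realisations_cat u1 u2 v : word_realisations theta (u1 ++ u2) v <->
  exists v1 v2, [/\ word_realisations theta u1 v1,
    word_realisations theta u2 v2 & v = v1 ++ v2].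
Proof.
elim: u1 v => [|a u1 IH] v /=.
  split=> [uv|[v1 [v2 [/word_realisations_nil -> uv ->]]] //].
  by exists [::], v; split=> //; apply/word_realisations_nil.
split=> [/word_realisations_cons[w [v' [wa /IH[v1 [v2 [uv1 uv2 ->]]] ->]]]|].
  exists (w ++ v1), v2; rewrite catA; split=> //.
  by apply/word_realisations_cons; exists w, v1.
case=> v1 [v2 [/word_realisations_cons[w [v1' [wa uv1 ->]]] uv2 ->]].
apply/word_realisations_cons; exists w, (v1' ++ v2); rewrite catA; split=> //.
by apply/IH; exists v1', v2.
Qed.

(** [rs_power] starts from a single letter; starting from a word makes powers compatible with
    concatenation and composition. *)
Fixpoint iter_realisations k u : set (seq A) :=
  if k is k'.+1 then
    \bigcup_(v in iter_realisations k' u) word_realisations theta v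
  else [set u].

Lemma rs_powerE k a : rs_power theta k a = iter_realisations k [:: a].
Proof. by elim: k => //= k ->. Qed.

Lemma iter_realisations_cat k u1 u2 v1 v2 :
  iter_realisations k u1 v1 -> iter_realisations k u2 v2 ->
  iter_realisations k (u1 ++ u2) (v1 ++ v2).
Proof.
elim: k v1 v2 => [|k IH] v1 v2 /= => [-> -> //|[w1 uw1 wv1] [w2 uw2 wv2]].
by exists (w1 ++ w2); [exact: IH|apply/word_realisations_cat; exists v1, v2].
Qed.

Lemma iter_realisationsD j k u v : iter_realisations (j + k) u v <->
  exists2 w, iter_realisations j u w & iter_realisations k w v.
Proof.
elim: k v => [|k IH] v.
  by rewrite addn0; split=> [uv|[w uw /= ->] //]; exists v.
rewrite addnS /=; split=> [[w' /IH[w uw ww'] w'v]|[w uw [w' ww' w'v]]].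
  by exists w => //; exists w'.
by exists w' => //; apply/IH; exists w.
Qed.

Lemma iter_realisations_letter a w :
  w \in theta a -> iter_realisations 1 [:: a] w.
Proof. by rewrite -rs_powerE rs_power1. Qed.

Lemma word_realisations_exists u : exists v, word_realisations theta u v.
Proof.
elim: u => [|a u [v uv]]; first by exists [::]; apply/word_realisations_nil.
have /fset0Pn[w wa] := realisations_neq0 theta a.
by exists (w ++ v); apply/word_realisations_cons; exists w, v.
Qed.

Lemma iter_realisations_exists k u : exists v, iter_realisations k u v.
Proof.
elim: k => [|k [w uw]]; first by exists u.
by have [v wv] := word_realisations_exists w; exists v => /=; exists w.
Qed.

Definition max_size := \max_a \max_(w <- theta a) size w.

Lemma size_realisation a w : w \in theta a -> 0 < size w <= max_size.
Proof.
move=> wa; apply/andP; split.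
  by case: w wa => //; rewrite (negbTE (realisations_nonempty theta a)).
apply: leq_trans (leq_bigmax a).
exact: (@leq_bigmax_seq _ (enum_fset (theta a)) xpredT (fun w : seq A => size w)
  w wa isT).
Qed.

Lemma size_word_realisations u v :
  word_realisations theta u v -> size u <= size v <= max_size * size u.
Proof.
elim: u v => [|a u IH] v; first by move=> /word_realisations_nil ->.
case/word_realisations_cons => w [v' [/size_realisation wa /IH v'u ->]] /=.
rewrite size_cat; nia.
Qed.

Lemma size_iter_realisations k u v :
  iter_realisations k u v -> size u <= size v <= max_size ^ k * size u.
Proof.
elim: k v => [|k IH] v /=; first by move=> ->; rewrite mul1n leqnn.
case=> w /IH uw /size_word_realisations wv; rewrite expnS; nia.
Qed.

Lemma iter_realisations_infix k u u' v : infix u u' ->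
  iter_realisations k u v -> exists2 v', iter_realisations k u' v' & infix v v'.
Proof.
case/infixP => p [q ->] uv.
have [p' pp'] := iter_realisations_exists k p.
have [q' qq'] := iter_realisations_exists k q.
exists (p' ++ v ++ q'); last exact: infix_infix.
by do !apply: iter_realisations_cat.
Qed.

End Realisations.

(** * Legal words and their two-sided extensions under primitivity *)

Section Legal.
Variables (A : finType) (theta : random_substitution A).
Hypothesis theta_primitive : primitive theta.
Implicit Types (a b c : A) (u v w : seq A) (k : nat).

Lemma legal_realisation k a u v :
  0 < k -> iter_realisations theta k [:: a] v -> infix u v -> legal theta u.
Proof. by move=> k_gt0 av uv; exists k, a, v; rewrite rs_powerE. Qed.

Lemma legal_infix u v : infix u v -> legal theta v -> legal theta u.
Proof.
move=> uv [k [a [w [k_gt0 aw vw]]]].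
by exists k, a, w; split=> //; apply: infix_trans vw.
Qed.

Lemma legal_iter_realisations k u v :
  legal theta u -> iter_realisations theta k u v -> legal theta v.
Proof.
move=> [j [a [w [j_gt0]]]]; rewrite rs_powerE => aw uw uv.
have [v' wv' vv'] := iter_realisations_infix uw uv.
apply: (@legal_realisation (j + k) a _ v') => //.
  by rewrite addn_gt0 j_gt0.
by apply/iter_realisationsD; exists w.
Qed.

(** Primitivity provides a single exponent [K]. For larger [k], the first [k - K] steps lead from
    [b] to a non-empty word, and [K] further steps from its first letter reach [a]. *)
Lemma primitive_mem : exists2 K, 0 < K & forall k, K <= k ->
  forall a b, exists2 v, iter_realisations theta k [:: b] v & a \in v.
Proof.
have [_ [K [K_gt0 HK]]] := theta_primitive.
exists K => // k /subnK <- a b.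
have [v bv] := iter_realisations_exists theta (k - K) [:: b].
case: v bv => [/size_iter_realisations//|c v] bv.
have [w + aw] := HK a c; rewrite rs_powerE => cw.
have [w' vw'] := iter_realisations_exists theta K v.
exists (w ++ w'); last by rewrite mem_cat aw.
apply/iter_realisationsD; exists (c :: v) => //.
exact: (@iter_realisations_cat _ _ _ [:: c]).
Qed.

Lemma legal_size_exists n : exists2 u, legal theta u & size u = n.
Proof.
have [[x Xx] _] := theta_primitive.
by exists (Defs.factor x 0%R n); [exact: Xx|rewrite size_mkseq].
Qed.

(** A legal word of three letters is realised: the outer letters produce the two occurrences of [a],
    the middle one produces [u]. *)
Lemma legal_extend k b v u a :
  iter_realisations theta k [:: b] v -> infix u v ->
  exists p q, [/\ a \in p, a \in q & legal theta (p ++ u ++ q)].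
Proof.
move=> bv uv.
have [K K_gt0 HK] := primitive_mem.
have [w + w3] := legal_size_exists 3.
case: w w3 => [|z1 [|z2 [|z3 []]]] //= _ zL.
have mem2 j c z : exists2 w, iter_realisations theta (K + j) [:: z] w & c \in w.
  by apply: HK; exact: leq_addr.
have [w1 z1w1 a1] := mem2 (K + k) a z1.
have [w3 z3w3 a3] := mem2 (K + k) a z3.
have [w2 + bw2] := mem2 0 b z2; rewrite addn0 => z2w2.
have [w2' w2w2' bw2'] :
    exists2 w, iter_realisations theta (K + (K + k)) [:: z2] w & infix u w.
  (* The middle letter must spend as many steps as the outer ones: [K] from [z2] to a word
     containing [b], [K] from [b] to a word containing [b] again, and [k] from there to [v]. *)
  have [w bw cw] := mem2 0 b b; rewrite addn0 in bw.
  have bw2i : infix [:: b] w2 by rewrite infix1s //.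
  have bwi : infix [:: b] w by rewrite infix1s //.
  have [x wx vx] := iter_realisations_infix bwi bv.
  have [y w2y xy] : exists2 y, iter_realisations theta (K + k) w2 y & infix x y.
    apply: (iter_realisations_infix bw2i).
    by apply/iter_realisationsD; exists w.
  exists y; first by apply/iter_realisationsD; exists w2.
  by apply: infix_trans uv _; apply: infix_trans vx _.
case/infixP: bw2' => p [q w2'E].
exists (w1 ++ p), (q ++ w3); rewrite !mem_cat a1 a3 orbT; split=> //.
have -> : (w1 ++ p) ++ u ++ q ++ w3 = w1 ++ w2' ++ w3.
  by rewrite w2'E -!catA.
apply: legal_iter_realisations zL _; rewrite -cat1s -[z2 :: _]cat1s.
by do 2?apply: iter_realisations_cat; eassumption.
Qed.

Lemma legal_extend_legal u a : legal theta u ->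
  exists p q, [/\ a \in p, a \in q & legal theta (p ++ u ++ q)].
Proof. by case=> k [b [v []]] _; rewrite rs_powerE; exact: legal_extend. Qed.

End Legal.

(** * Legal words occur in points of the subshift *)

Lemma infix_take_drop (T : eqType) (k n : nat) (s : seq T) :
  infix (take n (drop k s)) s.
Proof.
by apply/infixP; exists (take k s), (drop n (drop k s)); rewrite !cat_take_drop.
Qed.

Section Factors.
Variables (A : finType) (theta : random_substitution A).
Hypothesis theta_primitive : primitive theta.
Implicit Types (a b c : A) (u v w : seq A) (k : nat).

(* The point is the union of an increasing sequence of legal words extending
   [u]; each is stored as its reversed part to the left of the origin and its
   part to the right, so that both components only grow at their ends. *)
Lemma legal_factor u : legal theta u ->
  exists2 x, subshift theta x & exists i, Defs.factor x i (size u) = u.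
Proof.
move=> uL.
have [_ [d _]] := uL.
(* Asking that [d] occur in both extensions makes them non-empty, so each stage grows on both
   sides. *)
have /boolp.choice[E HE] v : exists pq : seq A * seq A, legal theta v ->
    [/\ 0 < size pq.1, 0 < size pq.2 & legal theta (pq.1 ++ v ++ pq.2)].
  have [vL|vNL] := pselect (legal theta v); last by exists ([::], [::]).
  have [p [q [dp dq pq]]] := legal_extend_legal theta_primitive d vL.
  by exists (p, q) => _; split=> //; case: (p) dp; case: (q) dq.
pose step (lr : seq A * seq A) :=
  (lr.1 ++ rev (E (rev lr.1 ++ lr.2)).1, lr.2 ++ (E (rev lr.1 ++ lr.2)).2).
pose S n := iter n step ([::], u).
have SL n : legal theta (rev (S n).1 ++ (S n).2) /\
    (n <= size (S n).1) && (n <= size (S n).2).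
  elim: n => [|n [SnL szS]] //=.
  have [p0 q0 pq] := HE _ SnL.
  rewrite rev_cat revK !size_cat size_rev; rewrite !catA in pq *; split=> //.
  by move: p0 q0 szS; rewrite -/(S n); lia.
have S_prefix n m : n <= m ->
    prefix (S n).1 (S m).1 && prefix (S n).2 (S m).2.
  elim: m => [|m IH]; first by rewrite leqn0 => /eqP ->; rewrite !prefix_refl.
  rewrite leq_eqVlt => /orP[/eqP ->|]; first by rewrite !prefix_refl.
  rewrite ltnS => /IH /andP[p1 p2] /=.
  by rewrite (prefix_trans p1 (prefix_prefix _ _))
    (prefix_trans p2 (prefix_prefix _ _)).
have nth_prefix (s t : seq A) j :
    prefix s t -> j < size s -> nth d s j = nth d t j.
  by move=> /prefixP[r ->] js; rewrite nth_cat js.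
(* Both components of [S n.+1] have more than [n] letters, so the default [d] is never read.
   [Negz n] is [-(n+1)], hence index [n] in the reversed left part. *)
pose x (i : int) := match i with
  | Posz n => nth d (S n.+1).2 n | Negz n => nth d (S n.+1).1 n end.
have x_pos m n : n < size (S m).2 -> x (Posz n) = nth d (S m).2 n.
  move=> nm; have /andP[_ szn] := (SL n.+1).2.
  have [le|/ltnW le] := leqP m n.+1;
    have /andP[_ /nth_prefix H] := S_prefix _ _ le.
    by rewrite /= H.
  exact: H.
have x_neg m n : n < size (S m).1 -> x (Negz n) = nth d (S m).1 n.
  move=> nm; have /andP[szn _] := (SL n.+1).2.
  have [le|/ltnW le] := leqP m n.+1;
    have /andP[/nth_prefix H _] := S_prefix _ _ le.
    by rewrite /= H.
  exact: H.
have x_nth m j : j < size (rev (S m).1 ++ (S m).2) ->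
    x (Posz j - Posz (size (S m).1))%R = nth d (rev (S m).1 ++ (S m).2) j.
  rewrite size_cat size_rev nth_cat size_rev => jm; case: ltnP => jl.
    rewrite nth_rev // -x_neg; last by lia.
    by congr x; lia.
  by rewrite -x_pos; [congr x; lia|lia].
have factorE m i n : `|i|%N + n <= m -> Defs.factor x i n =
    take n (drop `|(Posz (size (S m).1) + i)%R|%N (rev (S m).1 ++ (S m).2)).
  move=> le; have /andP[lm rm] := (SL m).2.
  have sz : n <= size (drop `|(Posz (size (S m).1) + i)%R|%N
      (rev (S m).1 ++ (S m).2)).
    by rewrite size_drop size_cat size_rev; lia.
  apply: (@eq_from_nth _ d); rewrite size_mkseq ?size_takel //.
  move=> j jn; rewrite nth_mkseq // nth_take // nth_drop -x_nth.
    by congr x; lia.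
  by move: sz; rewrite size_drop; lia.
exists x.
  move=> i n; rewrite (factorE _ i n (leqnn _)).
  exact: legal_infix (infix_take_drop _ _ _) (SL _).1.
exists 0%R; apply: (@eq_from_nth _ d); rewrite size_mkseq // => j ju.
by rewrite nth_mkseq // add0r (x_pos 0).
Qed.

End Factors.

(** * The complexity function and the Morse-Hedlund dichotomy *)

Lemma inj_Some (T : Type) : injective (@Some T).
Proof. by move=> x y []. Qed.

Section Complexity.
Variables (A : finType) (X : set (int -> A)).

Definition factor_tuples n := [pred t : n.-tuple A |
  `[< exists2 w, X w & exists i : int, Defs.factor w i n = t >]].

Lemma factor_tuplesP n (t : n.-tuple A) :
  reflect (exists2 w, X w & exists i, Defs.factor w i n = t)
          (t \in factor_tuples n).
Proof. exact: asboolP. Qed.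

Lemma complexity_le_card (T : finType) (f : T -> seq A) n :
  (forall w i, X w -> exists t, Defs.factor w i n = f t) ->
  complexity X n <= #|T|.
Proof.
(* Some [f t] may fail to have length [n], hence the option type. *)
move=> Xf; pose g t : option (n.-tuple A) := insub (f t).
apply: leq_trans (leq_image_card g T).
rewrite -[complexity X n](card_image (@inj_Some (n.-tuple A))
  (factor_tuples n)).
apply/subset_leq_card/fintype.subsetP.
move=> _ /fintype.imageP[t /factor_tuplesP[w Xw [i wt]] ->].
have [x wx] := Xf w i Xw; apply/fintype.imageP; exists x => //.
by rewrite /g -wx wt valK.
Qed.

Lemma card_le_complexity (T : finType) (f : T -> seq A) n : injective f ->
  (forall t, exists2 w, X w & exists i, Defs.factor w i n = f t) ->
  #|T| <= complexity X n.
Proof.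
move=> f_inj Xf; have f_size t : size (f t) == n.
  by have [w _ [i <-]] := Xf t; rewrite size_mkseq.
pose g t := Tuple (f_size t).
have g_inj : injective g by move=> t t' /(congr1 val); exact: f_inj.
rewrite -(card_codom g_inj).
apply/subset_leq_card/fintype.subsetP => _ /codomP[t ->].
by apply/factor_tuplesP; exact: Xf.
Qed.

Lemma take_factor n m (w : int -> A) i :
  n <= m -> take n (Defs.factor w i m) = Defs.factor w i n.
Proof. by move=> nm; rewrite -map_take take_iota (minn_idPl nm). Qed.

Lemma complexity_le_factors n m : n <= m ->
  (forall w w' i i', X w -> X w' -> Defs.factor w i n = Defs.factor w' i' n ->
     Defs.factor w i m = Defs.factor w' i' m) ->
  complexity X m <= complexity X n.
Proof.
move=> nm Xinj.
pose g (t : m.-tuple A) : option (n.-tuple A) := insub (take n t).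
have gE (t : m.-tuple A) :
    exists2 s : n.-tuple A, val s = take n t & g t = Some s.
  have st : size (take n t) == n by rewrite size_takel // size_tuple.
  by exists (Tuple st) => //; rewrite /g (insubT (fun s => size s == n) st).
have g_inj : {in factor_tuples m &, injective g}.
  move=> t t' /factor_tuplesP[w Xw [i wt]] /factor_tuplesP[w' Xw' [i' wt']].
  have [s st ->] := gE t; have [s' st' ->] := gE t'.
  move=> [] /(congr1 val); rewrite st st' -wt -wt' !take_factor //.
  by move=> /(Xinj _ _ _ _ Xw Xw'); rewrite wt wt' => /val_inj.
rewrite -[complexity X m](card_in_image g_inj).
rewrite -[complexity X n](card_image (@inj_Some (n.-tuple A))
  (factor_tuples n)).
apply/subset_leq_card/fintype.subsetP.
move=> _ /fintype.imageP[t /factor_tuplesP[w Xw [i wt]] ->].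
have [s st ->] := gE t; apply/fintype.imageP; exists s => //.
by apply/factor_tuplesP; exists w => //; exists i; rewrite st -wt take_factor.
Qed.

Lemma complexity_le_image n m : n <= m -> complexity X n <=
  #|[seq (insub (take n (val t)) : option (n.-tuple A)) |
      t in factor_tuples m]|.
Proof.
move=> nm.
rewrite -[complexity X n](card_image (@inj_Some (n.-tuple A))
  (factor_tuples n)).
apply/subset_leq_card/fintype.subsetP.
move=> _ /fintype.imageP[t /factor_tuplesP[w Xw [i wt]] ->].
have ws : size (Defs.factor w i m) == m by rewrite size_mkseq.
apply/fintype.imageP; exists (Tuple ws).
  by apply/factor_tuplesP; exists w => //; exists i.
by rewrite /= take_factor // wt valK.
Qed.

Lemma complexity_mono n m : n <= m -> complexity X n <= complexity X m.
Proof.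
by move=> nm; exact: leq_trans (complexity_le_image nm) (leq_image_card _ _).
Qed.

(** Truncation maps the factors of length [m] onto those of length [n]; if the former are not more
    numerous, it is injective. *)
Lemma complexity_le_inj n m : n <= m -> complexity X m <= complexity X n ->
  forall w w' i i', X w -> X w' -> Defs.factor w i n = Defs.factor w' i' n ->
    Defs.factor w i m = Defs.factor w' i' m.
Proof.
move=> nm le w w' i i' Xw Xw' ww'.
pose g (t : m.-tuple A) : option (n.-tuple A) := insub (take n t).
have /fintype.image_injP g_inj :
    #|[seq g t | t in factor_tuples m]| == #|factor_tuples m|.
  by rewrite eqn_leq leq_image_card (leq_trans le (complexity_le_image nm)).
have ws : size (Defs.factor w i m) == m by rewrite size_mkseq.
have ws' : size (Defs.factor w' i' m) == m by rewrite size_mkseq.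
suff /(congr1 val) : Tuple ws = Tuple ws' by [].
apply: g_inj; last by rewrite /g /= !take_factor // ww'.
  by apply/factor_tuplesP; exists w => //; exists i.
by apply/factor_tuplesP; exists w' => //; exists i'.
Qed.

Lemma complexity_gt0 n : (X !=set0)%classic -> 0 < complexity X n.
Proof.
move=> [w Xw]; have ws : size (Defs.factor w 0%R n) == n by rewrite size_mkseq.
apply/card_gt0P; exists (Tuple ws).
by apply/factor_tuplesP; exists w => //; exists 0%R.
Qed.

(** If the complexity fails to grow from some [n] to [n.+1], then [n] consecutive letters determine
    the next one, hence all later ones, and [complexity X n] is a bound. Otherwise it increases
    strictly from a positive value at 0. *)
Lemma morse_hedlund : (X !=set0)%classic ->
  (exists B, forall n, complexity X n <= B) \/ (forall n, n < complexity X n).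
Proof.
move=> X0; have [[n pn]|pN] :=
  pselect (exists n, complexity X n.+1 <= complexity X n).
  left; exists (complexity X n) => m.
  have [/ltnW/complexity_mono //|nm] := ltnP m n.
  apply: complexity_le_factors => // w w' i i' Xw Xw'.
  have step := complexity_le_inj (leqnSn n) pn.
  move=> ww'.
  have sh k : Defs.factor w (i + k%:Z)%R n = Defs.factor w' (i' + k%:Z)%R n.
    elim: k => [|k /step - /(_ Xw Xw') /(congr1 behead)].
      by rewrite !addr0.
    rewrite /Defs.factor /mkseq /= -[1]/(1 + 0) iotaDl -!map_comp => e.
    have shE (v : int -> A) j : [seq v (j + k.+1%:Z + h%:Z)%R | h <- iota 0 n] =
        [seq v (j + k%:Z + (1 + h)%:Z)%R | h <- iota 0 n].
      by apply: eq_map => h; congr v; lia.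
    by rewrite !shE; exact: e.
  apply: eq_mkseq => k.
  (* The windows of length [n] may be empty, so the letter at offset [k] is read from their
     extensions to length [n.+1]. *)
  have := step _ _ _ _ Xw Xw' (sh k).
  by move/(congr1 (head (w 0%R))); rewrite /= !addr0.
right; elim=> [|n IH]; first exact: complexity_gt0.
rewrite ltnNge; apply/negP => le; apply: pN; exists n; exact: leq_trans le IH.
Qed.

End Complexity.

(** At such lengths [L] the logarithm of the complexity, divided by [L], is at least
    [m * ln 2 / L >= ln 2 / D], which stays away from 0. *)
Lemma htop0_subexponential (R : realType) (A : finType) (X : set (int -> A))
    (D : nat) : is_htop X (0 : R) ->
  ~ (forall m, exists2 L, m <= L <= D * m & 2 ^ m <= complexity X L).
Proof.
move=> X0 Xexp.
have ln2 : (0 < ln 2 :> R)%R by rewrite ln_gt0 // ltr1n.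
have D_gt0 : 0 < D.
  by have [L + _] := Xexp 1; case: (D) => // /andP[]; case: (L).
have D_gt0R : (0 < D%:R :> R)%R by rewrite ltr0n.
have /cvgrPdist_lt/(_ (ln 2 / D%:R)%R) := X0.
rewrite divr_gt0 // => /(_ isT)[N _ HN].
(* Taking [m = N.+1] puts [L] in the range of [HN] and makes it positive. *)
have [L /andP[mL LD] pL] := Xexp N.+1.
have := HN L (leq_trans (leqnSn N) mL); rewrite /= sub0r normrN => lt.
have L_gt0 : (0 < L%:R :> R)%R by rewrite ltr0n (leq_trans _ mL).
have := le_lt_trans (ler_norm _) lt; apply/negP; rewrite -leNgt.
rewrite ler_pdivrMr // -mulrA ler_pdivlMl //.
have /(@ler_wpM2r R D%:R%R (ltW D_gt0R)) :
    (ln 2 *+ N.+1 <= ln (complexity X L)%:R :> R)%R.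
  rewrite -lnXn ?ltr0n // ler_ln ?posrE ?exprn_gt0 ?ltr0n //.
    by rewrite -natrX ler_nat.
  by rewrite (leq_trans _ pL) // expn_gt0.
apply: le_trans; rewrite -[(_ *+ N.+1)%R]mulr_natr [leLHS]mulrC -mulrA.
by rewrite ler_pM2l // -natrM ler_nat mulnC.
Qed.

(** * Zero entropy and realisations of equal length *)

Section EqualLengths.
Variables (A : finType) (theta : random_substitution A).
Hypothesis theta_primitive : primitive theta.
Implicit Types (a b c : A) (u v w : seq A) (k : nat).

Definition select_blocks (s s' : A -> seq A) (t : seq bool) w :=
  flatten [seq if p.1 then s p.2 else s' p.2 | p <- zip t w].

(** Equal block lengths keep the block boundaries aligned, so each bit can be read off its own
    block. *)
Lemma select_blocks_inj s s' w (t t' : seq bool) :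
  (forall b, size (s b) = size (s' b)) -> (forall b, s b <> s' b) ->
  size t = size w -> size t' = size w ->
  select_blocks s s' t w = select_blocks s s' t' w -> t = t'.
Proof.
move=> ss' s_neq; elim: w t t' => [|b w IH] [|e t] [|e' t'] //= [tw] [tw'].
move/eqP; rewrite eqseq_cat; last by case: (e); case: (e'); rewrite /= ?ss'.
case/andP => /eqP ee' /eqP /(IH _ _ tw tw') ->; congr (_ :: _).
by case: e e' ee' => -[] // => [/s_neq|/esym/s_neq].
Qed.

Lemma select_blocks_realisation k s s' w (t : seq bool) :
  (forall b, iter_realisations theta k [:: b] (s b)) ->
  (forall b, iter_realisations theta k [:: b] (s' b)) ->
  size t = size w -> iter_realisations theta k w (select_blocks s s' t w).
Proof.
move=> sk s'k; elim: w t => [|b w IH] [|e t] //=.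
  move=> _; elim: k {sk s'k} => //= k IH.
  by exists [::] => //; apply/word_realisations_nil.
move=> [/IH tw]; rewrite -cat1s; apply: iter_realisations_cat => //.
by case: e.
Qed.

Lemma size_select_blocks s s' w (t : seq bool) :
  (forall b, size (s b) = size (s' b)) -> size t = size w ->
  size (select_blocks s s' t w) = sumn [seq size (s b) | b <- w].
Proof.
move=> ss'; elim: w t => [|b w IH] [|e t] //= [/IH <-].
by rewrite size_cat; case: e; rewrite /= ?ss'.
Qed.

Lemma exponential_complexity k c u v :
  iter_realisations theta k [:: c] u -> iter_realisations theta k [:: c] v ->
  size u = size v -> u <> v ->
  exists D, forall m,
    exists2 L, m <= L <= D * m & 2 ^ m <= complexity (subshift theta) L.
Proof.
move=> cu cv uv_size uv; have [K K_gt0 HK] := primitive_mem theta_primitive.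
(* By primitivity every letter [b] reaches a word containing [c]; inserting [u] or [v] at that [c],
   with the same surroundings, gives two distinct realisations of [b] of equal length. *)
have /boolp.choice[ss Hss] b : exists ss : seq A * seq A,
    [/\ iter_realisations theta (K + k) [:: b] ss.1,
        iter_realisations theta (K + k) [:: b] ss.2,
        size ss.1 = size ss.2 & ss.1 <> ss.2].
  have [w bw cw] := HK K (leqnn K) c b.
  case/splitPr: cw bw => w1 w2 bw.
  have [x1 wx1] := iter_realisations_exists theta k w1.
  have [x2 wx2] := iter_realisations_exists theta k w2.
  exists (x1 ++ u ++ x2, x1 ++ v ++ x2) => /=; split.
  - apply/iter_realisationsD; exists (w1 ++ c :: w2) => //; rewrite -cat1s.
    by do 2?apply: iter_realisations_cat.
  - apply/iter_realisationsD; exists (w1 ++ c :: w2) => //; rewrite -cat1s.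
    by do 2?apply: iter_realisations_cat.
  - by rewrite !size_cat uv_size.
  - by move/eqP; rewrite eqseq_cat // eqxx /= eqseq_cat // eqxx andbT => /eqP.
pose s b := (ss b).1; pose s' b := (ss b).2.
have sP b : iter_realisations theta (K + k) [:: b] (s b) by case: (Hss b).
have s'P b : iter_realisations theta (K + k) [:: b] (s' b) by case: (Hss b).
have s_size b : size (s b) = size (s' b) by case: (Hss b).
have s_neq b : s b <> s' b by case: (Hss b).
(* In [K + k] steps a letter grows at most by this factor. A legal word of length [m] then yields
   [2 ^ m] legal words of one length. *)
exists (max_size theta ^ (K + k)) => m.
have [w wL <-] := legal_size_exists theta_primitive m.
exists (sumn [seq size (s b) | b <- w]).
  have nw : size (nseq (size w) true) = size w by rewrite size_nseq.
  rewrite -(size_select_blocks s_size nw).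
  exact: size_iter_realisations (select_blocks_realisation sP s'P nw).
rewrite -card_bool -card_tuple.
apply: (@card_le_complexity _ _ _
  (fun t : (size w).-tuple bool => select_blocks s s' t w)).
  move=> t t' /(select_blocks_inj s_size s_neq (size_tuple t) (size_tuple t')).
  exact: val_inj.
move=> t; have tw := select_blocks_realisation sP s'P (size_tuple t).
rewrite -(size_select_blocks s_size (size_tuple t)).
exact: legal_factor (legal_iter_realisations wL tw).
Qed.

Lemma htop0_realisation_size_inj (R : realType) k c u v :
  is_htop (subshift theta) (0 : R)%R ->
  iter_realisations theta k [:: c] u -> iter_realisations theta k [:: c] v ->
  size u = size v -> u = v.
Proof.
move=> X0 cu cv uv; apply: contrapT => neq.
by have [D /(htop0_subexponential X0)] := exponential_complexity cu cv uv neq.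
Qed.

End EqualLengths.

(** * Commuting words and factors of powers of a word *)

Lemma commute_prefix_power (T : eqType) (z s : seq T) : z ++ s = s ++ z ->
  s != [::] -> exists N, prefix z (flatten (nseq N s)).
Proof.
(* [z] commutes with every power of [s]. As [s] is non-empty, its power of exponent [size z] is at
   least as long as [z], hence begins with [z]. *)
move=> zs s0; exists (size z).
have comm N : z ++ flatten (nseq N s) = flatten (nseq N s) ++ z.
  by elim: N => [|N IH] /=; rewrite ?cats0 // catA zs -!catA IH.
have : prefix z (flatten (nseq (size z) s) ++ z) by rewrite -comm prefix_prefix.
rewrite !prefixE take_cat size_flatten /shape map_nseq sumn_nseq.
case: ltnP => // le.
have -> : size z - size s * size z = 0.
  by apply/eqP; rewrite subn_eq0 leq_pmull // lt0n size_eq0.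
by rewrite take0 cats0 => /eqP zE; rewrite take_oversize ?zE.
Qed.

Lemma nth_flatten_nseq (T : Type) (d : T) (s : seq T) N j : j < N * size s ->
  nth d (flatten (nseq N s)) j = nth d s (j %% size s).
Proof.
elim: N j => //= N IH j jN; rewrite nth_cat; case: ltnP => js.
  by rewrite modn_small.
by rewrite IH -1?[in RHS](subnK js) ?modnDr //; lia.
Qed.

(** Only the starting position modulo [size s] matters, which leaves at most [size s] factors of
    each length. *)
Lemma infix_power_mkseq (T : eqType) (d : T) (w s : seq T) N : s != [::] ->
  infix w (flatten (nseq N s)) -> exists i : 'I_(size s),
    w = mkseq (fun j => nth d s ((i + j) %% size s)) (size w).
Proof.
rewrite -size_eq0 -lt0n => s0 /infixP[p [q e]].
exists (Ordinal (ltn_pmod (size p) s0)); apply: (@eq_from_nth _ d).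
  by rewrite size_mkseq.
move=> j jw; rewrite nth_mkseq //= modnDml -(@nth_flatten_nseq _ d s N).
  by rewrite e nth_cat ltnNge leq_addr /= addKn nth_cat jw.
have := congr1 size e; rewrite size_flatten /shape map_nseq sumn_nseq mulnC.
by rewrite !size_cat; lia.
Qed.

(** * Zero entropy and realisations of unequal length *)

Section UnequalLengths.
Variables (R : realType) (A : finType) (theta : random_substitution A).
Hypothesis theta_primitive : primitive theta.
Hypothesis theta_htop0 : is_htop (subshift theta) (0 : R)%R.
Implicit Types (a b c : A) (u v w : seq A) (k : nat).

(** Reduces to a single letter: [w] sits in a realisation [p ++ w ++ q] of some [c], and realising
    [p] and [q] identically in both cases lets them cancel. *)
Lemma htop0_legal_size_inj k w u v : legal theta w ->
  iter_realisations theta k w u -> iter_realisations theta k w v ->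
  size u = size v -> u = v.
Proof.
move=> [j [c [x [_ + /infixP[p [q xE]]]]]]; rewrite rs_powerE xE => cx wu wv uv.
have [p' pp'] := iter_realisations_exists theta k p.
have [q' qq'] := iter_realisations_exists theta k q.
have /eqP : p' ++ u ++ q' = p' ++ v ++ q'.
  apply: (@htop0_realisation_size_inj _ _ theta_primitive R (j + k) c) => //.
  - by apply/iter_realisationsD; exists (p ++ w ++ q);
      do ?apply: iter_realisations_cat.
  - by apply/iter_realisationsD; exists (p ++ w ++ q);
      do ?apply: iter_realisations_cat.
  - by rewrite !size_cat uv.
by rewrite eqseq_cat // eqxx /= eqseq_cat // eqxx andbT => /eqP.
Qed.

(** Both sides realise the legal word [a y a] and have the same length, even if [u] and [v] do
    not. *)
Lemma htop0_return_swap a y x u v :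
  legal theta (a :: y ++ [:: a]) -> iter_realisations theta 1 y x ->
  u \in theta a -> v \in theta a -> u ++ x ++ v = v ++ x ++ u.
Proof.
move=> aya yx /iter_realisations_letter ua /iter_realisations_letter va.
rewrite -cat1s in aya.
apply: (htop0_legal_size_inj (k := 1) aya); last by rewrite !size_cat; lia.
  by do ?apply: iter_realisations_cat.
by do ?apply: iter_realisations_cat.
Qed.

Lemma legal_infix_return a w : legal theta w -> exists y x,
  [/\ legal theta (a :: y ++ [:: a]), iter_realisations theta 1 y x &
    infix w x].
Proof.
move=> [[|k] [b [v [// _]]]]; rewrite rs_powerE => -[y by_ yv] wv.
(* [y] is the word before the last substitution step. It may come from exponent 0, which
   [legal_extend] allows. *)
have [p [q [+ +]]] := legal_extend theta_primitive a by_ (infix_refl y).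
case/splitPr => p1 p2; case/splitPr => q1 q2 L.
have [p2' pp2] := iter_realisations_exists theta 1 p2.
have [q1' qq1] := iter_realisations_exists theta 1 q1.
exists (p2 ++ y ++ q1), (p2' ++ v ++ q1'); split.
- apply: legal_infix L; apply/infixP; exists p1, q2.
  by rewrite -!catA /= -!catA.
- by do ?apply: iter_realisations_cat => //; exists y.
- by apply: infix_trans wv _; exact: infix_infix.
Qed.

(* If [u] and [v = u s] are both realisations of [a], then [u x v = v x u] says
   that [x u] commutes with [s], so that [x] is a factor of a power of [s]. *)
Lemma htop0_bounded_of_size_lt a u v :
  u \in theta a -> v \in theta a -> size u < size v ->
  exists B, forall n, complexity (subshift theta) n <= B.
Proof.
move=> ua va uv; pose s := drop (size u) v.
have s0 : s != [::] by rewrite -size_eq0 size_drop -lt0n subn_gt0.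
have L w : legal theta w -> exists N, infix w (flatten (nseq N s)).
  move=> /(legal_infix_return a)[y [x [aya yx wx]]].
  have swap := htop0_return_swap aya yx ua va.
  have vE : v = u ++ s.
    rewrite -[LHS](cat_take_drop (size u)); congr (_ ++ _).
    have := congr1 (take (size u)) swap.
    by rewrite take_size_cat // takel_cat // ltnW.
  have /commute_prefix_power[//|N xuN] : (x ++ u) ++ s = s ++ (x ++ u).
    have /eqP := swap; rewrite vE -!catA eqseq_cat // eqxx /=.
    by move/eqP.
  exists N; apply: infix_trans wx _; apply: infix_trans _ (prefixW xuN).
  exact: (infix_infix [::]).
exists (size s) => n; case: (s) s0 L => // d s' _ L.
rewrite -[leqRHS]card_ord.
pose f (i : 'I_(size (d :: s'))) :=
  mkseq (fun j => nth d (d :: s') ((i + j) %% size (d :: s'))) n.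
apply: (complexity_le_card (f := f)) => w i Xw.
have [N /(infix_power_mkseq (s := d :: s') d isT)[j]] := L _ (Xw i n).
by rewrite size_mkseq; exists j.
Qed.

Lemma htop0_bounded_or_deterministic :
  (exists B, forall n, complexity (subshift theta) n <= B) \/
  (forall (a : A) (u v : seq A), u \in theta a -> v \in theta a -> u = v).
Proof.
have [det|] := pselect (forall (a : A) (u v : seq A),
  u \in theta a -> v \in theta a -> u = v).
  by right.
move=> /existsNP[a] /existsNP[u] /existsNP[v].
move=> /not_implyP[ua] /not_implyP[va uv].
left; have [lt|lt|e] := ltngtP (size u) (size v).
- exact: htop0_bounded_of_size_lt ua va lt.
- exact: htop0_bounded_of_size_lt va ua lt.
case: uv; apply: (htop0_realisation_size_inj theta_primitive theta_htop0
  (k := 1) (c := a)) => //.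
  exact: iter_realisations_letter.
exact: iter_realisations_letter.
Qed.

End UnequalLengths.

(** * Linear complexity of deterministic primitive substitutions *)

Lemma take_drop_catl (T : Type) (n i : nat) (s t : seq T) : i + n <= size s ->
  take n (drop i (s ++ t)) = take n (drop i s).
Proof.
move=> le; rewrite drop_cat; case: ltnP => lei.
  by rewrite takel_cat // size_drop; lia.
have -> : n = 0 by lia.
by rewrite !take0.
Qed.

Section Deterministic.
Variables (A : finType) (theta : random_substitution A).
Hypothesis theta_primitive : primitive theta.
Hypothesis theta_det : forall (a : A) (u v : seq A),
  u \in theta a -> v \in theta a -> u = v.
Implicit Types (a b c : A) (u v w : seq A) (k : nat).

Lemma word_realisations_det w u v :
  word_realisations theta w u -> word_realisations theta w v -> u = v.
Proof.
elim: w u v => [|a w IH] u v.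
  by move=> /word_realisations_nil -> /word_realisations_nil ->.
move=> /word_realisations_cons[x [u' [xa wu' ->]]].
move=> /word_realisations_cons[y [v' [ya wv' ->]]].
by rewrite (theta_det xa ya) (IH _ _ wu' wv').
Qed.

Lemma iter_realisations_det k w u v :
  iter_realisations theta k w u -> iter_realisations theta k w v -> u = v.
Proof.
elim: k u v => [|k IH] u v /=; first by move=> -> ->.
move=> [x wx xu] [y wy yv]; rewrite -(IH _ _ wx wy) in yv.
exact: word_realisations_det xu yv.
Qed.

Definition subst_iter k w := projT1 (cid (iter_realisations_exists theta k w)).

Lemma subst_iterP k w : iter_realisations theta k w (subst_iter k w).
Proof. exact: projT2 (cid (iter_realisations_exists theta k w)). Qed.

Lemma subst_iterE k w v : iter_realisations theta k w v -> v = subst_iter k w.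
Proof. by move=> wv; exact: iter_realisations_det wv (subst_iterP k w). Qed.

Lemma subst_iter_nil k : subst_iter k [::] = [::].
Proof.
by have /andP[_] := size_iter_realisations (subst_iterP k [::]);
  rewrite muln0 leqn0 size_eq0 => /eqP.
Qed.

Lemma subst_iter_cat k u v :
  subst_iter k (u ++ v) = subst_iter k u ++ subst_iter k v.
Proof.
by apply/esym/subst_iterE; apply: iter_realisations_cat; exact: subst_iterP.
Qed.

Lemma subst_iterD j k w : subst_iter (j + k) w = subst_iter k (subst_iter j w).
Proof.
apply/esym/subst_iterE/iter_realisationsD.
by exists (subst_iter j w); exact: subst_iterP.
Qed.

Lemma size_subst_iter k w :
  size w <= size (subst_iter k w) <= max_size theta ^ k * size w.
Proof. exact: size_iter_realisations (subst_iterP k w). Qed.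

Lemma subst_iter_mem k a w : a \in w ->
  infix (subst_iter k [:: a]) (subst_iter k w).
Proof.
case/splitPr => w1 w2; rewrite -(cat1s a w2) !subst_iter_cat.
exact: infix_infix.
Qed.

(** When every block has length at least [n], a window of length [n] meets at most two consecutive
    blocks. *)
Lemma subst_iter_window p n i w : 0 < n ->
  (forall a, n <= size (subst_iter p [:: a])) ->
  i + n <= size (subst_iter p w) ->
  exists b c j, j < size (subst_iter p [:: b]) /\
    take n (drop i (subst_iter p w)) = take n (drop j (subst_iter p [:: b; c])).
Proof.
move=> n_gt0 np; elim: w i => [|b w IH] i.
  by rewrite subst_iter_nil /=; lia.
rewrite -cat1s subst_iter_cat size_cat => le.
have [ib|bi] := ltnP i (size (subst_iter p [:: b])); last first.
  have [|b' [c' [j [jb' e]]]] := IH (i - size (subst_iter p [:: b])).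
    by lia.
  by exists b', c', j; split=> //; rewrite drop_cat ltnNge bi.
case: w IH le => [|c w] _ le.
  exists b, b, i; split=> //; rewrite -[[:: b; b]]cat1s subst_iter_cat.
  rewrite subst_iter_nil in le *; rewrite cats0 take_drop_catl //.
  by rewrite addn0 in le.
exists b, c, i; split=> //.
rewrite -[c :: w]cat1s -[[:: b; c]]cat1s !subst_iter_cat catA take_drop_catl //.
by rewrite size_cat; have := np c; lia.
Qed.

(* Take the least [p] for which all the words [subst_iter p [:: a]] have
   length at least [n]: by primitivity they are then of length [O(n)]. *)
Lemma deterministic_linear :
  exists C, forall n, 0 < n -> complexity (subshift theta) n <= C * n.
Proof.
have [K K_gt0 HK] := primitive_mem theta_primitive.
have memK k a b : K <= k -> a \in subst_iter k [:: b].
  by move=> /HK /(_ a b)[v /subst_iterE <-].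
have growth n : exists p, [forall a, n <= size (subst_iter p [:: a])].
  have [w [k [c [v [_]]]]] := legal_size_exists theta_primitive n.
  rewrite rs_powerE => /subst_iterE -> /size_infix wv wn.
  exists (K + k); apply/forallP => a; rewrite subst_iterD -wn (leq_trans wv) //.
  exact: size_infix (subst_iter_mem _ (memK _ _ _ (leqnn K))).
exists (#|A| * #|A| * max_size theta ^ K.+1) => n n_gt0.
case: (ex_minnP (growth n)) => p /forallP np p_min.
have max_p a : size (subst_iter p [:: a]) <= max_size theta ^ K.+1 * n.
  have M_gt0 : 0 < max_size theta.
    have /fset0Pn[x /size_realisation/andP[x_gt0]] := realisations_neq0 theta a.
    exact: leq_trans.
  have [pK|Kp] := leqP p K.
    have /andP[_ le] := size_subst_iter p [:: a]; apply: leq_trans le _.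
    by rewrite leq_mul // leq_pexp2l // ltnW.
  have [b bn] : exists b, size (subst_iter p.-1 [:: b]) < n.
    apply/existsP; rewrite -[X in is_true X]negbK negb_exists.
    apply/negP => /forallP H.
    have : p <= p.-1 by apply: p_min; apply/forallP => b; rewrite leqNgt.
    by lia.
  (* After [K] steps [b] has produced every letter [a], so the image of [a] after [p.-1 - K] steps
     fits in the short image of [b]. The remaining [K.+1] steps cost at most the factor
     [max_size theta ^ K.+1]. *)
  have pE : p.-1 = K + (p.-1 - K) by lia.
  have an : size (subst_iter (p.-1 - K) [:: a]) <= n.
    apply: leq_trans (ltnW bn); rewrite pE subst_iterD -pE.
    exact: size_infix (subst_iter_mem _ (memK _ _ _ (leqnn K))).
  have -> : p = p.-1 - K + K.+1 by lia.
  rewrite subst_iterD.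
  have /andP[_ le] := size_subst_iter K.+1 (subst_iter (p.-1 - K) [:: a]).
  by apply: leq_trans le _; rewrite leq_mul2l an orbT.
(* A factor of length [n] is coded by two consecutive letters and a starting position in the block
   of the first. *)
pose f (t : A * A * 'I_(max_size theta ^ K.+1 * n)) :=
  take n (drop t.2 (subst_iter p [:: t.1.1; t.1.2])).
rewrite -mulnA -[X in _ * X]card_ord -!card_prod.
apply: (complexity_le_card (f := f)) => w i /(_ i n).
have : size (Defs.factor w i n) = n by rewrite size_mkseq.
move: (Defs.factor w i n) => u un [k [a [v [k_gt0]]]].
rewrite rs_powerE => /subst_iterE -> uv.
(* The exponent [k] may be smaller than [p]; since [a] recurs in its own image after [K + p] steps,
   [u] also occurs at exponent [K + p + k]. *)
have {uv} : infix u (subst_iter p (subst_iter (K + k) [:: a])).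
  apply: infix_trans uv _; rewrite -subst_iterD addnAC subst_iterD.
  exact: subst_iter_mem (memK _ _ _ (leq_addr _ _)).
case/infixP => l [r e].
have uE : u = take n (drop (size l) (subst_iter p (subst_iter (K + k) [:: a]))).
  by rewrite e drop_size_cat // -un take_size_cat.
have le : size l + n <= size (subst_iter p (subst_iter (K + k) [:: a])).
  by rewrite e !size_cat un addnA leq_addr.
have [b [c [j [jb e']]]] := subst_iter_window n_gt0 np le.
have jn : j < max_size theta ^ K.+1 * n := leq_trans jb (max_p b).
by exists (b, c, Ordinal jn); rewrite uE e'.
Qed.

End Deterministic.

(** * Constants for the two growth rates, and the conclusion *)

Local Open Scope ring_scope.

Lemma is_Theta1 (R : realType) (p : nat -> nat) (B : nat) :
  (forall n, 0 < p n <= B)%N ->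
  is_Theta (fun n => (p n)%:R : R) (fun _ => 1).
Proof.
(* The quotient [1 / p n] lies between [1 / B] and 1; [B.+1] and 2 make both inequalities strict. *)
move=> pB; exists B.+1%:R^-1, 2%:R; split; rewrite ?invr_gt0 ?ltr0n // => n _.
have /andP[p_gt0 pn] := pB n.
have p_gt0R : (0 < (p n)%:R :> R) by rewrite ltr0n.
rewrite ltr_pdivrMr // mul1r ltf_pV2 ?posrE ?ltr0n // ltr_nat ltnS pn /=.
by rewrite -natrM ltr1n; lia.
Qed.

Lemma is_Theta_id (R : realType) (p : nat -> nat) (C : nat) :
  (forall n, 0 < n -> n < p n <= C * n)%N ->
  is_Theta (fun n => (p n)%:R : R) (fun n => n%:R).
Proof.
(* The quotient [n / p n] is already strictly below 1; only the lower bound [1 / C] has to be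
   relaxed. *)
move=> pC; exists C.+1%:R^-1, 1; split; rewrite ?invr_gt0 ?ltr0n // => n n_gt0.
have /andP[np pn] := pC n n_gt0.
have p_gt0R : (0 < (p n)%:R :> R) by rewrite ltr0n (leq_ltn_trans _ np).
rewrite ltr_pdivlMr // ltr_pdivrMr // ltr_pdivrMl ?ltr0n // mul1r.
by rewrite -natrM !ltr_nat np andbT (leq_ltn_trans pn) // mulSn; lia.
Qed.

Theorem corollary3p2 (R : realType) (A : finType)
    (theta : random_substitution A) (htheta : primitive theta)
    (hentropy : is_htop (subshift theta) (0 : R)) :
  is_Theta (fun n : nat => (complexity (subshift theta) n)%:R : R)
           (fun _ : nat => 1) \/
  is_Theta (fun n : nat => (complexity (subshift theta) n)%:R : R)
           (fun n : nat => n%:R).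
Proof.
have X0 : (subshift theta !=set0)%classic by have [] := htheta.
have bounded B : (forall n, complexity (subshift theta) n <= B)%N ->
    is_Theta (fun n => (complexity (subshift theta) n)%:R : R) (fun _ => 1).
  by move=> pB; apply: (@is_Theta1 _ _ B) => n; rewrite complexity_gt0 //=.
have [[B pB]|det] := htop0_bounded_or_deterministic htheta hentropy.
  by left; exact: bounded pB.
have [[B pB]|p_gt] := morse_hedlund X0; first by left; exact: bounded pB.
right; have [C pC] := deterministic_linear htheta det.
by apply: (@is_Theta_id _ _ C) => n n_gt0; rewrite p_gt pC.
Qed.
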